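(* For any graph $G$ on $n$ vertices with maximum degree $\Delta$, $$HG(G) \leq 1+\frac{3n}{4}+\frac{\Delta^2}{4n}.$$ In particular, for every $\varepsilon>0$ there exist $\zeta=\zeta(\varepsilon)>0$, independent of $n$, and $n_0=n_0(\varepsilon)$ such that for every $n\ge n_0$ and every graph $G$ on $n$ vertices with maximum degree $\Delta(G)\leq (1-\varepsilon)n$, one has $HG(G)\leq (1-\zeta)n$.
   Context: Graphs are finite and simple, with at least one vertex. Let $G$ be a graph on $n$ vertices and let $k\ge 1$ be an integer. A $k$-coloring of $G$ is an arbitrary (not necessarily proper) map $c:V(G)\to\{1,\ldots,k\}$ (hat colors). A guessing strategy $\mathcal{S}$ with $k$ colors is a deterministic rule assigning to each vertex $v$ a function that takes the colors $(c(w))_{w\in N(v)}$ of the neighbors of $v$ (not including $v$ itself) and outputs a guess in $\{1,\ldots,k\}$. Vertex $v$ guesses correctly in $c$ if its guess equals $c(v)$. The strategy is winning if for every $k$-coloring $c$ at least one vertex guesses correctly. The hat guessing number $HG(G)$ is the largest $k$ for which a winning guessing strategy with $k$ colors exists. *)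

(* Defs.v *)
From HB Require Import structures.
From mathcomp Require Import all_boot all_order all_algebra.
From mathcomp Require Import reals.
Set Implicit Arguments.
Unset Strict Implicit.
Unset Printing Implicit Defensive.

Record sgraph := SGraph {
  vertex :> finType;
  adj : rel vertex;
  adj_sym : symmetric adj;
  adj_irrefl : irreflexive adj;
  vertex_gt0 : 0 < #|vertex|
}.

Definition max_degree (G : sgraph) : nat :=
  \max_(v : G) #|[set w : G | adj v w]|.

Section HatGuessing.
Variable G : sgraph.

Definition nbr (v : G) : finType := {w : G | adj v w}.

(* The hat colors 1, ..., k are encoded as the elements 0, ..., k-1 of 'I_k. *)
Definition coloring (k : nat) : finType := {ffun G -> 'I_k}.

(* A strategy gives each vertex v a function of the colors of its neighbors
   only: its argument is indexed by the subtype nbr v, which excludes v. *)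
Definition strategy (k : nat) : finType :=
  {dffun forall v : G, {ffun {ffun nbr v -> 'I_k} -> 'I_k}}.

Definition seen k (c : coloring k) (v : G) : {ffun nbr v -> 'I_k} :=
  [ffun w => c (val w)].

Definition guesses_correctly k (S : strategy k) (c : coloring k) (v : G) :
  bool := S v (seen c v) == c v.

Definition winning k (S : strategy k) : bool :=
  [forall c : coloring k, [exists v : G, guesses_correctly S c v]].

(* k = 0 is excluded: there is no coloring with 0 colors, so that any strategy
   would win vacuously. *)
Definition winnable (k : nat) : bool :=
  (0 < k) && [exists S : strategy k, winning S].

Lemma winnable_ex : exists k, winnable k.
Proof.
exists 1; apply/andP; split=> //; apply/existsP.
exists (finfun (fun v : G => [ffun=> ord0]) : strategy 1).
apply/forallP=> c; case/card_gt0P: (vertex_gt0 G) => v _.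
apply/existsP; exists v.
by rewrite /guesses_correctly !ord1.
Qed.

Lemma card_correct k (S : strategy k) (v : G) :
  #|[set c | guesses_correctly S c v]| * k <= #|coloring k|.
Proof.
pose A := [set c | guesses_correctly S c v].
pose upd (p : coloring k * 'I_k) : coloring k :=
  [ffun w => if w == v then p.2 else p.1 w].
have seen_upd p : seen (upd p) v = seen p.1 v.
  apply/ffunP=> w; rewrite !ffunE; case: eqP => // wv.
  by have := valP w; rewrite /= wv adj_irrefl.
have injU : {in setX A setT &, injective upd}.
  move=> [c x] [d y]; rewrite !inE !andbT /= => /eqP cP /eqP dP eq_u.
  have eq_s : seen c v = seen d v by rewrite -(seen_upd (c, x)) eq_u seen_upd.
  have eq_w w : upd (c, x) w = upd (d, y) w by rewrite eq_u.
  congr (_, _); last by have := eq_w v; rewrite !ffunE eqxx.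
  apply/ffunP=> w; have := eq_w w; rewrite !ffunE /=.
  by case: eqP => // -> _; rewrite -cP -dP eq_s.
have := max_card [in upd @: setX A setT].
by rewrite card_in_imset // cardsX cardsT card_ord.
Qed.

Lemma winnable_bound k : winnable k -> k <= #|G|.
Proof.
case/andP=> k_gt0 /existsP[S /forallP winS].
have N_gt0 : 0 < #|coloring k| by rewrite card_ffun card_ord expn_gt0 k_gt0.
rewrite -(leq_pmul2l N_gt0).
apply: (@leq_trans (\sum_(v : G) #|[set c | guesses_correctly S c v]| * k)).
  rewrite -big_distrl leq_mul2r; apply/orP; right.
  under eq_bigr do rewrite -sum1dep_card big_mkcond /=.
  rewrite exchange_big /= -sum1_card leq_sum // => c _.
  by have /existsP[v cv] := winS c; rewrite (bigD1 v) //= cv.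
rewrite mulnC -sum_nat_const; apply: leq_sum => v _.
exact: card_correct.
Qed.

(* ex_maxn yields the true maximum of winnable; the value does not depend on the
   bound #|G| used to show that a maximum exists. *)
Definition HG : nat := ex_maxn winnable_ex winnable_bound.

Lemma HGP : winnable HG /\ forall k, winnable k -> k <= HG.
Proof. by rewrite /HG; case: ex_maxnP. Qed.

End HatGuessing.

(* Main.v *)
(** Let [J] be the (nonempty) set of vertices guessing correctly on a uniformly
    random coloring, and [N[v]] the closed neighborhood of [v].  Whether [J] is
    contained in [N[v]] does not depend on the color of [v], because it only
    concerns the vertices outside [N[v]]; it is thus independent of the event
    that [v] guesses correctly, which has probability [1/k].  At most
    [Delta + 1] vertices [v] satisfy that [J] is contained in [N[v]], so the
    expected number of such [v] in [J] is at most [(Delta + 1)/k].  This number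
    plus [#|J|] is always at least [2] (if [J = {v}], then [v] is counted in
    both), whence [2 <= n/k + (Delta + 1)/k], that is [2k <= n + Delta + 1],
    which is stronger than the claimed bound. *)
Require Import Defs.
From HB Require Import structures.
From mathcomp Require Import all_boot all_order all_algebra.
From mathcomp Require Import reals.
From mathcomp Require Import ring lra.
Set Implicit Arguments.
Unset Strict Implicit.
Unset Printing Implicit Defensive.
Import Order.TTheory GRing.Theory Num.Theory.
Local Open Scope ring_scope.

Section CorrectSet.
Local Open Scope nat_scope.
Variables (G : sgraph) (k : nat) (S : strategy G k).

Definition correct_set (c : coloring G k) : {set G} :=
  [set v | guesses_correctly S c v].

Definition closed_nbr (v : G) : {set G} := v |: [set w | adj v w].

Lemma closed_nbr_sym u v : (u \in closed_nbr v) = (v \in closed_nbr u).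
Proof. by rewrite !inE eq_sym adj_sym. Qed.

Lemma card_closed_nbr v : #|closed_nbr v| <= (max_degree G).+1.
Proof.
rewrite cardsU1 inE adj_irrefl add1n ltnS.
exact: (leq_bigmax (F := fun v : G => #|[set w | adj v w]|)).
Qed.

Lemma guesses_correctly_local (c d : coloring G k) u :
  {in closed_nbr u, c =1 d} -> guesses_correctly S c u = guesses_correctly S d u.
Proof.
move=> cd; rewrite /guesses_correctly cd ?setU11 //; congr (S u _ == _).
by apply/ffunP=> w; rewrite !ffunE cd // !inE (valP w) orbT.
Qed.

(** If [u] is outside the closed neighborhood of [v], then [v] is outside that of [u], so recoloring
    [v] changes neither the color nor the guess of [u]. *)
Lemma sub_closed_nbr_local v (c d : coloring G k) :
    (forall w, w != v -> c w = d w) ->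
  correct_set c \subset closed_nbr v -> correct_set d \subset closed_nbr v.
Proof.
move=> cd /subsetP sub_c; apply/subsetP=> u; rewrite inE => du.
apply/negPn/negP=> uv; have cu : u \in correct_set c.
  rewrite inE (guesses_correctly_local (d := d)) // => w wu.
  by apply: cd; apply: contraNneq uv => <-; rewrite closed_nbr_sym.
by have := sub_c u cu; rewrite (negPf uv).
Qed.

(** Recoloring [v] in all [k] ways preserves [P] and is injective on the colorings where [v] is
    correct: the old color of [v] is its guess, which the unchanged neighbors determine. *)
Lemma card_correct_cond v (P : pred (coloring G k)) :
    (forall c d : coloring G k,
       (forall w, w != v -> c w = d w) -> P c -> P d) ->
  #|[set c | guesses_correctly S c v && P c]| * k <= #|[set c | P c]|.
Proof.
move=> Ploc; set A := [set c | _ && _].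
pose upd (p : coloring G k * 'I_k) : coloring G k :=
  [ffun w => if w == v then p.2 else p.1 w].
have updE p w : w != v -> upd p w = p.1 w by rewrite ffunE => /negPf->.
have injU : {in setX A setT &, injective upd}.
  move=> [c x] [d y]; rewrite !inE !andbT /=.
  move=> /andP[/eqP cP _] /andP[/eqP dP _] eq_u.
  have eq_w w : w != v -> c w = d w.
    by move=> wv; rewrite -(updE (c, x)) // eq_u updE.
  have eq_s : seen c v = seen d v.
    apply/ffunP=> w; rewrite !ffunE eq_w //.
    by apply: contraTneq (valP w) => ->; rewrite adj_irrefl.
  congr (_, _); last by have /ffunP/(_ v) := eq_u; rewrite !ffunE eqxx.
  apply/ffunP=> w; have [->|/eq_w //] := eqVneq w v.
  by rewrite -cP -dP eq_s.
rewrite -[X in _ * X]card_ord -cardsT -cardsX -(card_in_imset injU).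
apply/subset_leq_card/subsetP=> _ /imsetP[[c x] + ->].
rewrite !inE andbT /= => /andP[_]; apply: Ploc => w wv.
by rewrite updE.
Qed.

Lemma card_correct_set_ge2 (c : coloring G k) :
    0 < #|correct_set c| ->
  2 <= #|correct_set c|
       + #|[set v in correct_set c | correct_set c \subset closed_nbr v]|.
Proof.
rewrite leq_eqVlt => /predU1P[/esym/eqP/cards1P[v ->]|J_gt1]; last first.
  exact: leq_trans J_gt1 (leq_addr _ _).
rewrite cards1 add1n ltnS card_gt0; apply/set0Pn; exists v.
by rewrite !inE sub1set setU11 eqxx.
Qed.

(** Fix one correct vertex [u]: by symmetry, every such [v] lies in the closed neighborhood of
    [u]. *)
Lemma card_sub_closed_nbr (c : coloring G k) :
    0 < #|correct_set c| ->
  #|[set v | correct_set c \subset closed_nbr v]| <= (max_degree G).+1.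
Proof.
case/card_gt0P=> u Ju; apply: leq_trans (card_closed_nbr u).
apply/subset_leq_card/subsetP=> v; rewrite inE => /subsetP/(_ u Ju).
by rewrite closed_nbr_sym.
Qed.

Lemma sum_card_swap (P : coloring G k -> pred G) :
  \sum_c #|[set v | P c v]| = \sum_v #|[set c | P c v]|.
Proof.
under eq_bigr do rewrite -sum1dep_card big_mkcond /=.
by rewrite exchange_big; apply: eq_bigr => v _; rewrite -big_mkcond sum1dep_card.
Qed.

Lemma winning_double_bound :
  0 < k -> winning S -> k.*2 <= #|G| + (max_degree G).+1.
Proof.
move=> k_gt0 /forallP winS.
have J_gt0 c : 0 < #|correct_set c|.
  by have /existsP[v cv] := winS c; apply/card_gt0P; exists v; rewrite inE.
have N_gt0 : 0 < #|coloring G k| by rewrite card_ffun card_ord expn_gt0 k_gt0.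
pose in_sub c v := (v \in correct_set c) && (correct_set c \subset closed_nbr v).
have sumJ : (\sum_c #|correct_set c|) * k <= #|G| * #|coloring G k|.
  rewrite sum_card_swap big_distrl /= -sum_nat_const.
  by apply: leq_sum => v _; apply: card_correct.
have sumK : (\sum_c #|[set v | in_sub c v]|) * k
            <= (max_degree G).+1 * #|coloring G k|.
  rewrite sum_card_swap big_distrl /= mulnC -sum_nat_const.
  (* The pairs of a coloring and a vertex are counted by vertex to use independence, then by
     coloring to use the degree bound. *)
  apply: (@leq_trans
    (\sum_c #|[set v | correct_set c \subset closed_nbr v]|)); last first.
    by apply: leq_sum => c _; apply: card_sub_closed_nbr.
  rewrite sum_card_swap; apply: leq_sum => v _.
  have -> : [set c | in_sub c v] = [set c | guesses_correctly S c v
              && (correct_set c \subset closed_nbr v)].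
    by apply/setP=> c; rewrite !inE /in_sub inE.
  apply: card_correct_cond => c d; exact: sub_closed_nbr_local.
(* Scaling by the number of colorings turns expectations into sums, in which each coloring
   contributes at least 2. *)
rewrite -(leq_pmul2r N_gt0) mulnDl; apply: leq_trans (leq_add sumJ sumK).
rewrite -mulnDl -big_split /= -mul2n -mulnA [k * _]mulnC mulnA leq_mul2r.
apply/orP; right; rewrite mulnC -sum_nat_const.
by apply: leq_sum => c _; apply: card_correct_set_ge2.
Qed.

End CorrectSet.

Lemma HG_double_bound (G : sgraph) :
  ((HG G).*2 <= #|G| + (max_degree G).+1)%N.
Proof.
by have [/andP[HG_gt0 /existsP[S /(winning_double_bound HG_gt0)]]] := HGP G.
Qed.

Theorem corollary2 (R : realType) :
  (forall (n : nat) (G : sgraph), #|G| = n ->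
     (HG G)%:R <= 1 + 3 * n%:R / 4 + (max_degree G)%:R ^+ 2 / (4 * n%:R) :> R)
  /\
  (forall eps : R, 0 < eps ->
     exists (zeta : R) (n0 : nat), 0 < zeta /\
       forall (n : nat) (G : sgraph), (n0 <= n)%N -> #|G| = n ->
         (max_degree G)%:R <= (1 - eps) * n%:R ->
         (HG G)%:R <= (1 - zeta) * n%:R).
Proof.
have HG_le (G : sgraph) :
    2 * (HG G)%:R <= #|G|%:R + (max_degree G)%:R + 1 :> R.
  have := HG_double_bound G.
  by rewrite -(ler_nat R) -mul2n natrM natrD -[(max_degree G).+1]addn1 natrD addrA.
split=> [n G Gn | eps eps_gt0].
  have := HG_le G; rewrite Gn; set D := (max_degree G)%:R; set h := (HG G)%:R.
  have n_gt0 : 0 < n%:R :> R by rewrite ltr0n -Gn vertex_gt0.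
  move=> h_le.
  (* This square, plus 1/2, is the gap between the claimed bound and [(n + D + 1) / 2]. *)
  have sq_ge0 : 0 <= (n%:R - D) ^+ 2 / (4 * n%:R).
    by rewrite divr_ge0 ?sqr_ge0 // mulr_ge0 // ltW.
  suff E : 3 * n%:R / 4 + D ^+ 2 / (4 * n%:R)
           = (n%:R + D) / 2 + (n%:R - D) ^+ 2 / (4 * n%:R) by lra.
  by field; rewrite gt_eqF.
(* From [n0] on, [eps * n / 4] absorbs the additive 1/2 in [h <= (1 - eps / 2) * n + 1 / 2], where
   [h] is the hat guessing number; this leaves [zeta = eps / 4]. *)
have [n0 n0_ge] : exists n0 : nat, 2 / eps <= n0%:R.
  by exists (Num.bound (2 / eps)); rewrite ltW // archi_boundP // divr_ge0 // ltW.
exists (eps / 4), n0; split=> [|n G n0n Gn D_le]; first by rewrite divr_gt0.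
have := HG_le G; rewrite Gn.
have : 2 <= eps * n%:R.
  by rewrite mulrC -ler_pdivrMr // (le_trans n0_ge) // ler_nat.
by move: D_le; lra.
Qed.
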